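(* There exist absolute constants $C,C'>0$ such that the following holds. Let $n\ge2$, $d\ge1$, $\alpha\in(0,1)$ with $\alpha n$ an integer, $X\in\mathbb R^{n\times d}$ deterministic, $\beta^*\in\mathbb R^d$, and let $\boldsymbol\eta\in\mathbb R^n$ be a random vector satisfying the following: there is a random set $\mathbf R\subseteq[n]$ chosen uniformly among all subsets of size $\alpha n$ such that (1) $\boldsymbol\eta_1,\dots,\boldsymbol\eta_n$ are mutually conditionally independent given $\mathbf R$; (2) for all $i\in[n]$, $\Pr(\boldsymbol\eta_i\le0\mid\mathbf R)=\Pr(\boldsymbol\eta_i\ge0\mid\mathbf R)$; (3) for all $i\in\mathbf R$ there is a conditional density $p_i$ of $\boldsymbol\eta_i$ given $\mathbf R$ with $p_i(t)\ge0.1$ for all $t\in[-1,1]$. Let $\mathbf y=X\beta^*+\boldsymbol\eta$ and $\delta=C\cdot\frac{d\ln n}{\alpha^2 n}$, and suppose the column span of $X$ is $(\delta n,1/2)$-spread. Then with $h=1/n$, every minimizer $\hat\beta$ of $f_h(\beta)=\sum_{i=1}^n\Phi_h(\langle x_i,\beta\rangle-\mathbf y_i)$ satisfies \[\tfrac1n\|X(\hat\beta-\beta^* )\|^2\le\delta\] with probability at least $1-C' n^{-d/2}$.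
   Context: $x_1,\dots,x_n$ are the rows of $X$. For $h>0$, $\Phi_h(t)=\frac{t^2}{2h}$ if $|t|\le h$ and $\Phi_h(t)=|t|-h/2$ otherwise. A linear subspace $V\subseteq\mathbb R^n$ is $(m,\rho)$-spread if for every $v\in V$ and every $S\subseteq[n]$ with $|S|\ge n-m$ one has $\|v_S\|\ge\rho\|v\|$, where $v_S$ is the restriction of $v$ to coordinates in $S$. *)

(* Defs.v *)
From HB Require Import structures.
From mathcomp Require Import all_boot all_order all_algebra.
From mathcomp Require Import all_classical all_reals all_analysis.
From mathcomp Require Import Rstruct Rstruct_topology.
Set Implicit Arguments. Unset Strict Implicit. Unset Printing Implicit Defensive.
Import Order.TTheory GRing.Theory Num.Theory.
Local Open Scope ring_scope.
Local Open Scope classical_set_scope.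

Section Defs.
Variable R : realType.

Definition Phi (h t : R) : R :=
  if `|t| <= h then t ^+ 2 / (2 * h) else `|t| - h / 2.

Definition vnorm n (v : 'cV[R]_n) : R := Num.sqrt (\sum_i v i 0 ^+ 2).
Definition vnorm_on n (S : {set 'I_n}) (v : 'cV[R]_n) : R :=
  Num.sqrt (\sum_(i in S) v i 0 ^+ 2).

Definition spread n (V : set 'cV[R]_n) (m rho : R) : Prop :=
  forall v, V v -> forall S : {set 'I_n},
    n%:R - m <= #|S|%:R -> rho * vnorm v <= vnorm_on S v.

Definition colspan n d (X : 'M[R]_(n, d)) : set 'cV[R]_n :=
  [set v | exists w : 'cV[R]_d, v = X *m w].

Definition fh n d (h : R) (X : 'M[R]_(n, d)) (y : 'cV[R]_n) (beta : 'cV[R]_d) : R :=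
  \sum_i Phi h ((X *m beta) i 0 - y i 0).

Definition is_minimizer n d (h : R) (X : 'M[R]_(n, d)) (y : 'cV[R]_n) (b : 'cV[R]_d) :=
  forall b' : 'cV[R]_d, fh h X y b <= fh h X y b'.

Definition condP d0 (T : measurableType d0) (P : probability T R) (E A : set T) : R :=
  fine (P (A `&` E)) / fine (P E).

End Defs.

Definition RR : realType := Rdefinitions.R.

(* Main.v *)
Require Import Defs.
From HB Require Import structures.
From mathcomp Require Import all_boot all_order all_algebra.
From mathcomp Require Import all_classical all_reals all_analysis.
From mathcomp Require Import Rstruct Rstruct_topology.
From mathcomp Require Import measurable_realfun ring lra zify.
Import Order.TTheory GRing.Theory Num.Theory.
Local Open Scope ring_scope.
Local Open Scope classical_set_scope.

(* Since |t| - h/2 <= Phi_h(t) <= |t| and h = 1/n, a minimizer b gives v = X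
   (b - beta_star) with sum_i (|v_i - eta_i| - |eta_i|) <= 1/2. By convexity
   this persists when v is shrunk to the sphere |v|^2 = delta n, and rounding
   v to a net of that sphere raises the sum to at most 1. Each summand is at
   least |v_i| Z_i, where Z_i is 1 if eta_i and v_i do not have the same
   strict sign, 0 if eta_i lies between 0 and v_i/2, and -1 otherwise; the
   sign symmetry makes E Z_i >= 0, and the density bound makes E Z_i >=
   |v_i|/20 when i is in R and |v_i| <= 1. A Chernoff bound with rate
   alpha/1280, averaged over R, together with the spread condition, shows that
   sum_i |v_i| Z_i <= 1 has probability n^(-10 d) up to a factor n^3 at a
   fixed net point. The net has n^(6d) points: by Cramer's rule, the rows of X
   spanning the largest determinant express every other row with coefficients
   in [-1, 1], so rounding those at most d coordinates suffices. *)

(** * Moment generating functions of variables with values in {-1, 0, 1} *)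

Section Elementary.
Context {R : realType}.
Implicit Types s x p q r : R.

Lemma expRN_le x : 0 <= x -> expR (- x) <= (1 + x)^-1.
Proof.
move=> x0; rewrite expRN lef_pV2 ?posrE ?expR_gt0 ?expR_ge1Dx //.
by rewrite ltr_wpDr.
Qed.

Lemma expRN_le_half x : 0 <= x <= 1 -> expR (- x) <= 1 - x / 2.
Proof.
move=> /andP[x0 x1]; apply: le_trans (expRN_le _ x0) _.
have x1p : 0 < 1 + x by lra.
rewrite -div1r ler_pdivrMr //; nra.
Qed.

Lemma two_cosh_le s : 0 <= s <= 1/2 -> expR s + expR (- s) <= 2 + 4 * s ^+ 2.
Proof.
move=> /andP[s0 s1].
have h1 : expR s <= (1 - s)^-1.
  have : expR (- - s) <= (1 - s)^-1.
    rewrite expRN lef_pV2 ?posrE ?expR_gt0 ?expR_ge1Dx //; lra.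
  by rewrite opprK.
have h2 := expRN_le _ s0.
apply: le_trans (lerD h1 h2) _.
have -> : (1 - s)^-1 + (1 + s)^-1 = 2 / (1 - s ^+ 2).
  by field; apply/andP; split; [|apply/andP; split]; apply/eqP; nra.
rewrite ler_pdivrMr; last by nra.
have : s ^+ 2 <= 1/4 by nra.
have : 0 <= s ^+ 2 by nra.
nra.
Qed.

Lemma two_sinh_ge s : 0 <= s -> s <= expR s - expR (- s).
Proof.
move=> s0; have h1 := expR_ge1Dx s; have h2 : expR (- s) <= 1.
  by rewrite expR_le1 oppr_le0.
lra.
Qed.

(** Let Z be 1, 0, -1 with probabilities [p], [q], [r]; the left side is the mean of exp(-sZ). Split
    it into a cosh part, which costs at most 2 s^2, and a sinh part, which gains at least gs/2
    because the mean of Z is at least [g]. *)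
Lemma mgf_sign_le_drift s (g p q r : R) : 0 <= s <= 1/2 -> 0 <= p -> 0 <= q -> 0 <= r ->
  p + q + r = 1 -> 0 <= g <= p - r ->
  p * expR (- s) + q + r * expR s <= expR (2 * s ^+ 2 - g * s / 2).
Proof.
move=> s01 p0 q0 r0 pqr /andP[g0 gpr].
have c := two_cosh_le _ s01; have sh : s <= _ := two_sinh_ge s _.
have {sh} sh : s <= expR s - expR (- s) by apply: sh; case/andP: s01.
apply: le_trans (expR_ge1Dx _).
set u := expR s in c sh *; set w := expR (- s) in c sh *.
have -> : p * w + q + r * u =
   (p + r) / 2 * (u + w) - (p - r) / 2 * (u - w) + q by field.
have h1 : (p + r) / 2 * (u + w) <= (p + r) / 2 * (2 + 4 * s ^+ 2).
  by apply: ler_wpM2l => //; lra.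
have h2 : g / 2 * s <= (p - r) / 2 * (u - w).
  by apply: ler_pM => //; [lra | case/andP: s01 | lra].
have h3 : (p + r) * s ^+ 2 <= 1 * s ^+ 2 by apply: ler_wpM2r; [exact: sqr_ge0|lra].
have -> : q = 1 - p - r by lra.
lra.
Qed.

(** For s <= 1/2 this is the case of zero drift. For larger s the left side is at most exp(s), and s
    <= 2 s^2. Large s must be allowed, since nothing bounds the coordinates of a net point by 1. *)
Lemma mgf_sign_le s p q r : 0 <= s -> 0 <= p -> 0 <= q -> 0 <= r ->
  p + q + r = 1 -> r <= p ->
  p * expR (- s) + q + r * expR s <= expR (2 * s ^+ 2).
Proof.
move=> s0 p0 q0 r0 pqr rp.
have [s1|s1] := leP s (1/2).
  have := @mgf_sign_le_drift s 0 p q r.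
  by rewrite mul0r mul0r subr0; apply => //; [rewrite s0 | lra].
have e : expR s <= expR (2 * s ^+ 2) by rewrite ler_expR; nra.
apply: le_trans e.
have e1 : 1 <= expR s by rewrite -exp.expR0 ler_expR.
have e2 : expR (- s) <= expR s by rewrite ler_expR; lra.
rewrite [leRHS](_ : _ = p * expR s + q * expR s + r * expR s); last first.
  by rewrite -!mulrDl pqr mul1r.
rewrite lerD2r lerD // ?ler_wpM2l //.
by rewrite ler_peMr.
Qed.

End Elementary.

(** * Comparison of a uniform subset of fixed size with independent sampling *)

Section UniformSubset.
Local Open Scope nat_scope.

(** Up to the factor n^n, [b j] is the binomial probability of j with parameter k/n. The ratio of
    consecutive terms is at least 1 below k and at most 1 from k on, so the mode is k. *)
Lemma binomial_mode (n k j : nat) : k <= n -> j <= n ->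
  'C(n, j) * (k ^ j * (n - k) ^ (n - j)) <= 'C(n, k) * (k ^ k * (n - k) ^ (n - k)).
Proof.
move=> kn jn.
pose b i := 'C(n, i) * (k ^ i * (n - k) ^ (n - i)).
have step i : i < n -> b i.+1 * (i.+1 * (n - k)) = b i * ((n - i) * k).
  move=> ilt; rewrite /b.
  have e := mul_bin_left n i.
  rewrite (_ : n - i = (n - i.+1).+1); last by lia.
  rewrite !expnS.
  rewrite (_ : n - i = (n - i.+1).+1) in e; last by lia.
  move: e; move: (n - i.+1).+1 => m e.
  transitivity (i.+1 * 'C(n, i.+1) * (k * k ^ i * (n - k) ^ (n - i.+1) * (n - k))); first by ring.
  rewrite e; ring.
have b0 i : k = 0 -> 0 < i -> b i = 0.
  by rewrite /b => -> ?; rewrite exp0n // mul0n muln0.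
have bn i : k = n -> i < n -> b i = 0.
  by rewrite /b => -> ?; rewrite subnn exp0n ?subn_gt0 // muln0 muln0.
have up i : i < k -> b i <= b i.+1.
  move=> ik; case: (eqVneq k n) => [kn'|kn']; first by rewrite bn //; lia.
  have s := step i (leq_trans ik kn).
  have pos : 0 < i.+1 * (n - k) by rewrite muln_gt0 /=; lia.
  rewrite -(leq_pmul2r pos) s leq_mul2l; apply/orP; right; nia.
have dn i : k <= i -> i < n -> b i.+1 <= b i.
  move=> ki il; case: (eqVneq k 0) => [k0|k0]; first by rewrite b0.
  have s := step i il.
  have pos : 0 < i.+1 * (n - k) by rewrite muln_gt0 /=; lia.
  rewrite -(leq_pmul2r pos) s leq_mul2l; apply/orP; right; nia.
rewrite -/(b j) -/(b k).
have upk m : m <= k -> b (k - m) <= b k.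
  elim: m => [|m IH] mk; first by rewrite subn0.
  apply: leq_trans (IH (ltnW mk)).
  rewrite (_ : k - m = (k - m.+1).+1); last by lia.
  by apply: up; lia.
have dnk m : k + m <= n -> b (k + m) <= b k.
  elim: m => [|m IH] mk; first by rewrite addn0.
  apply: leq_trans (IH _); last by lia.
  by rewrite addnS; apply: dn; lia.
have [jk|kj] := leqP j k.
  by have := upk (k - j) (leq_subr _ _); rewrite subKn.
by have := dnk (j - k); rewrite subnKC ?(ltnW kj) //; apply.
Qed.

(** The n+1 binomial terms add up to n^n, and none exceeds the one at the mode. *)
Lemma binomial_mode_mass (n k : nat) : k <= n ->
  n ^ n <= n.+1 * ('C(n, k) * (k ^ k * (n - k) ^ (n - k))).
Proof.
move=> kn; rewrite -[X in X ^ n <= _](subnK kn) expnDn.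
rewrite -[X in X * _]card_ord -sum_nat_const.
apply: leq_sum => i _; rewrite [X in 'C(n, i) * X]mulnC.
by apply: binomial_mode => //; rewrite -ltnS.
Qed.

End UniformSubset.

(** Include each index independently with probability k/n: the product on the right is the resulting
    mean of the product of the chosen [c i]. The chosen set has size k with probability at least
    1/(n+1), and given this it is uniform, which costs the factor n+1. *)
Lemma sum_subset_prod_le {R : realType} (n k : nat) (c : 'I_n -> R) :
  (0 < n)%N -> (k <= n)%N -> (forall i, 0 <= c i) ->
  \sum_(S : {set 'I_n} | #|S| == k) \prod_(i in S) c i <=
  'C(n, k)%:R * n.+1%:R * \prod_i (1 - k%:R / n%:R * (1 - c i)).
Proof.
move=> n0 kn c0.
have nn0 : (n%:R : R) != 0 by rewrite pnatr_eq0 -lt0n.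
set p : R := k%:R / n%:R.
have qE : 1 - p = (n - k)%:R / n%:R by rewrite natrB // mulrBl divff.
have p0 : 0 <= p by rewrite divr_ge0.
have q0 : 0 <= 1 - p by rewrite qE divr_ge0.
have -> : \prod_i (1 - p * (1 - c i)) =
   \sum_(S : {set 'I_n}) \prod_i (if i \in S then p * c i else 1 - p).
  rewrite -bigA_distr; apply: eq_bigr => i _ /=. ring.
have h1 : \sum_(S : {set 'I_n} | #|S| == k) p ^+ k * (1 - p) ^+ (n - k) * \prod_(i in S) c i <=
   \sum_(S : {set 'I_n}) \prod_i (if i \in S then p * c i else 1 - p).
  rewrite [leRHS](bigID (fun S : {set 'I_n} => #|S| == k)) /=.
  rewrite -[leLHS]addr0; apply: lerD; last first.
    by apply: sumr_ge0 => S _; apply: prodr_ge0 => i _; case: ifP => // _; rewrite mulr_ge0.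
  apply: ler_sum => S /eqP Sk.
  rewrite [leRHS](bigID (mem S)) /=.
  rewrite [X in _ <= X * _](eq_bigr (fun i => p * c i)); last by move=> i ->.
  rewrite big_split /= prodr_const Sk.
  rewrite [X in _ <= _ * X](eq_bigr (fun=> 1 - p)); last by move=> i /negbTE ->.
  rewrite prodr_const.
  have -> : #|[pred i | i \notin S]| = (n - k)%N.
    by rewrite -Sk -[X in (X - _)%N](card_ord n) -(cardC (mem S)) addKn; apply: eq_card.
  by rewrite mulrAC.
apply: le_trans (ler_wpM2l _ h1); last by rewrite mulr_ge0.
rewrite -big_distrr /= mulrA ler_peMl ?sumr_ge0 // => [S _|].
  by apply: prodr_ge0.
have nn : 0 < (n%:R : R) ^+ n by rewrite exprn_gt0 // ltr0n.
rewrite qE /p !expr_div_n.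
have -> : 'C(n, k)%:R * n.+1%:R * (k%:R ^+ k / n%:R ^+ k * ((n - k)%:R ^+ (n - k) / n%:R ^+ (n - k)))
  = 'C(n, k)%:R * n.+1%:R * (k%:R ^+ k * (n - k)%:R ^+ (n - k)) / n%:R ^+ n :> R.
  have -> : (n%:R : R) ^+ n = n%:R ^+ k * n%:R ^+ (n - k) by rewrite -exprD subnKC.
  by field; rewrite !expf_neq0.
rewrite ler_pdivlMr // mul1r -!natrX -!natrM ler_nat mulnAC mulnC.
exact: binomial_mode_mass.
Qed.

(** * A finite net in a bounded part of the column span *)

Section Net.
Context {R : realType}.

(** Take [f] maximizing the absolute determinant of the selected rows. By Cramer's rule, entry (i,
    j) is a quotient of determinants: the numerator has row j of the selection replaced by row i, so
    it is no larger than the denominator. *)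
Lemma auerbach_rows (n r : nat) (B : 'M[R]_(n, r)) : row_full B ->
  exists f : 'I_r -> 'I_n, rowsub f B \in unitmx /\
    forall i j, `|(B *m invmx (rowsub f B)) i j| <= 1.
Proof.
move=> Bfull.
pose f0 := fullrankfun Bfull.
pose F (f : {ffun 'I_r -> 'I_n}) : R := `|\det (rowsub f B)|.
have [f _ fmax] := @Order.TotalTheory.arg_maxP _ _ _ f0 xpredT F isT.
set M := rowsub f B.
have Mu : M \in unitmx.
  rewrite unitmxE unitfE -normr_gt0; apply: lt_le_trans (fmax f0 isT).
  by rewrite normr_gt0 -unitfE -unitmxE; exact: fullrowsub_unit.
exists f; split=> // i j.
have dM : 0 < `|\det M| by rewrite normr_gt0 -unitfE -unitmxE.
pose f' : {ffun 'I_r -> 'I_n} := [ffun l => if l == j then i else f l].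
rewrite /invmx Mu -scalemxAr mxE normrM normfV ler_pdivrMl // mulr1.
apply: le_trans (fmax f' isT); rewrite /F (expand_det_row _ j) mxE.
rewrite le_eqVlt; apply/orP; left; apply/eqP; congr `|_|.
apply: eq_bigr => l _; rewrite !mxE ffunE eqxx; congr (_ * (_ * \det _)).
apply/matrixP => a b; rewrite !mxE ffunE.
by rewrite eq_sym (negbTE (neq_lift _ _)).
Qed.

(** Apply the determinant argument to a column basis B of X, with M its selected rows. A vector v =
    Bu equals (B M^-1)(Mu), where Mu lists the coordinates of v at [f] and B M^-1 has entries in
    [-1, 1]. *)
Lemma colspan_dominating_coords (n d : nat) (X : 'M[R]_(n, d)) :
  exists r (f : 'I_r -> 'I_n), [/\ (r <= n)%N, (r <= d)%N &
    forall v, colspan X v -> forall i, `|v i 0| <= \sum_j `|v (f j) 0| ].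
Proof.
have [f [Mu C1]] := auerbach_rows _ _ _ (col_base_full X).
exists (\rank X), f; split; rewrite ?rank_leq_row ?rank_leq_col // => v [w ->] i.
set M := rowsub f (col_base X) in Mu C1.
have vE : X *m w = col_base X *m (row_base X *m w) by rewrite mulmxA mulmx_base.
set u := row_base X *m w in vE.
have MuE j : (M *m u) j 0 = (X *m w) (f j) 0.
  by rewrite vE !mxE; apply: eq_bigr => l _; rewrite mxE.
have -> : X *m w = (col_base X *m invmx M) *m (M *m u).
  by rewrite vE -!mulmxA (mulmxA (invmx M)) mulVmx // mul1mx.
rewrite {1}mxE; apply: le_trans (ler_norm_sum _ _ _) _.
apply: ler_sum => j _; rewrite normrM.
rewrite -[X in _ <= `|X|]/((_ *m _) _ _).
have -> : (col_base X *m invmx M *m (M *m u)) (f j) 0 = (M *m u) j 0.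
  by rewrite -mulmxA (mulmxA (invmx M)) mulVmx // mul1mx -vE MuE.
by rewrite ler_piMl.
Qed.

(** Cut the range of each dominating coordinate into cells of width 1/(2 n^2). Two vectors of K in
    the same cell differ there by at most that width, and hence everywhere by at most r/(2 n^2) <=
    1/(2n). *)
Lemma colspan_net (n d : nat) (X : 'M[R]_(n, d)) (K : set 'cV[R]_n) :
  (2 <= n)%N -> K `<=` colspan X -> (forall v, K v -> forall i, `|v i 0| <= n%:R) ->
  exists (I : finType) (g : I -> 'cV[R]_n), [/\ (#|I| <= n ^ (6 * d))%N,
    forall a, K (g a) &
    forall v, K v -> exists a, forall i, `|v i 0 - g a i 0| <= (2 * n%:R)^-1].
Proof.
move=> n2 KX Kn.
have [[v0 Kv0]|K0] := pselect (exists v, K v); last first.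
  exists void, (fun=> 0); split=> [||v Kv]; [by rewrite card_void|by case|].
  by exfalso; apply: K0; exists v.
have [r [f [rn rd dom]]] := colspan_dominating_coords _ _ X.
(* The range [-n, n] has length 2n, and 2n times 2 n^2 is 4 n^3; the right endpoint adds one more
   cell, whence [m.+1]. *)
pose m := (4 * n ^ 3)%N.
pose x (v : 'cV[R]_n) j := (v (f j) 0 + n%:R) * (2 * n%:R ^+ 2).
pose cell v : {ffun 'I_r -> 'I_m.+1} := [ffun j => inord (Num.truncn (x v j))].
(* Each net point is a member of K in its cell, so the net stays inside K; empty cells get the
   default [v0]. *)
pose g a := xget v0 [set v | K v /\ cell v = a].
have n0 : 0 < n%:R :> R by rewrite ltr0n; lia.
exists {ffun 'I_r -> 'I_m.+1}, g; split.
- rewrite card_ffun !card_ord expnM.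
  apply: (@leq_trans ((n ^ 6) ^ r)); last by rewrite leq_pexp2l // expn_gt0; lia.
  have mn : (m < n ^ 6)%N.
    have : (2 ^ 3 <= n ^ 3)%N by rewrite leq_exp2r.
    by rewrite /m -[6%N]/(3 + 3)%N expnD; move: (n ^ 3)%N => z; nia.
  by case: (posnP r) => [->//|r0]; rewrite leq_exp2r.
- by move=> a; rewrite /g; case: xgetP => [v _ []|].
move=> v Kv; exists (cell v) => i.
have [Kg cg] : K (g (cell v)) /\ cell (g (cell v)) = cell v.
  rewrite /g; case: xgetP => [u _ //|/(_ v) h].
  by exfalso; apply: h.
set u := g (cell v) in Kg cg *.
have close j : `|(v - u) (f j) 0| <= (2 * n%:R ^+ 2)^-1.
  have xin w : K w -> 0 <= x w j /\ (Num.truncn (x w j) < m.+1)%N.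
    move=> /Kn /(_ (f j)); rewrite ler_norml => /andP[h1 h2].
    have p2 : 0 <= 2 * n%:R ^+ 2 :> R by rewrite mulr_ge0 // exprn_ge0 // ltW.
    have x0 : 0 <= x w j by rewrite mulr_ge0 //; lra.
    split=> //; rewrite truncn_lt_nat // -natr1.
    apply: (@le_lt_trans _ _ m%:R); last by rewrite ltrDl.
    rewrite /m natrM natrX /x [leRHS](_ : _ = (n%:R + n%:R) * (2 * n%:R ^+ 2)); last by ring.
    by rewrite ler_wpM2r //; lra.
  have [xv0 xvm] := xin v Kv; have [xu0 xum] := xin u Kg.
  have e : Num.truncn (x u j) = Num.truncn (x v j).
    move/ffunP: cg => /(_ j); rewrite !ffunE => /(congr1 (@nat_of_ord _)).
    by rewrite !inordK.
  have /andP[a1 a2] := truncn_itv xv0; have /andP[b1 b2] := truncn_itv xu0.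
  rewrite e in b1 b2.
  have : `|x v j - x u j| <= 1 by rewrite ler_norml; rewrite -natr1 in a2 b2; lra.
  rewrite /x -mulrBl normrM (_ : _ - _ = (v - u) (f j) 0); last by rewrite !mxE; lra.
  have p2 : 0 < 2 * n%:R ^+ 2 :> R by rewrite mulr_gt0 // exprn_gt0.
  by rewrite (gtr0_norm p2) -ler_pdivlMr // div1r.
have Xvu : colspan X (v - u).
  have [a ->] := KX _ Kv; have [b ->] := KX _ Kg.
  by exists (a - b); rewrite mulmxBr.
have := dom _ Xvu i; rewrite {1}mxE {1}[(- u) i 0]mxE => /le_trans; apply.
apply: le_trans (_ : \sum_(j < r) (2 * n%:R ^+ 2)^-1 <= _); first exact: ler_sum.
rewrite sumr_const card_ord -[leLHS]mulr_natl.
rewrite [leRHS](_ : _ = n%:R * (2 * n%:R ^+ 2)^-1); last by field; rewrite lt0r_neq0.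
by rewrite ler_wpM2r ?ler_nat // invr_ge0 mulr_ge0 // exprn_ge0 // ltW.
Qed.
End Net.

(** * Real-valued probabilities and conditional probabilities *)

Section FiniteProbability.
Context {d0 : measure_display} {T : measurableType d0} {R : realType} (P : probability T R).
Implicit Types A B E : set T.
Local Notation pr A := (fine (P A)).

Lemma pr_ge0 A : 0 <= pr A.
Proof. exact: fine_ge0. Qed.

Lemma pr_le A B : measurable A -> measurable B -> A `<=` B -> pr A <= pr B.
Proof.
by move=> mA mB AB; apply: fine_le; rewrite ?fin_num_measure //; apply: le_measure; rewrite ?inE.
Qed.

Lemma prU_le A B : measurable A -> measurable B -> pr (A `|` B) <= pr A + pr B.
Proof.
move=> mA mB; rewrite -fineD ?fin_num_measure //; apply: fine_le.
- by rewrite fin_num_measure //; exact: measurableU.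
- by rewrite fin_numD !fin_num_measure.
- exact: measureU2.
Qed.

Lemma prU A B : measurable A -> measurable B -> A `&` B = set0 ->
  pr (A `|` B) = pr A + pr B.
Proof. by move=> mA mB AB; rewrite -fineD ?fin_num_measure // measureU. Qed.

Lemma pr_setC A : measurable A -> pr (~` A) = 1 - pr A.
Proof.
by move=> mA; rewrite probability_setC // fineB ?fin_num_measure.
Qed.

Lemma pr_bigsetU_le (I : finType) (Q : pred I) (F : I -> set T) :
  (forall i, measurable (F i)) ->
  pr (\big[setU/set0]_(i | Q i) F i) <= \sum_(i | Q i) pr (F i).
Proof.
move=> mF; suff : measurable (\big[setU/set0]_(i | Q i) F i) /\
    pr (\big[setU/set0]_(i | Q i) F i) <= \sum_(i | Q i) pr (F i) by case.
apply: (big_rec2 (fun A x => measurable A /\ pr A <= x)); first by rewrite measure0.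
move=> i x A _ [mA Ax]; split; first exact: measurableU.
by apply: le_trans (prU_le _ _ (mF i) mA) _; rewrite lerD2l.
Qed.

Lemma pr_bigsetU (I : finType) (Q : pred I) (F : I -> set T) :
  (forall i, measurable (F i)) -> (forall i j x, F i x -> F j x -> i = j) ->
  pr (\big[setU/set0]_(i | Q i) F i) = \sum_(i | Q i) pr (F i).
Proof.
move=> mF dF; rewrite -big_filter -[RHS]big_filter.
have : uniq [seq i <- index_enum I | Q i] by rewrite filter_uniq // index_enum_uniq.
elim: {Q}[seq _ <- _ | _] => [_|i s IH /= /andP[nis us]].
  by rewrite !big_nil measure0.
rewrite !big_cons prU ?IH //; first by apply: bigsetU_measurable => j _.
apply/seteqP; split => x //= -[Fix].
rewrite -bigcup_seq => -[j /= js Fjx].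
by rewrite (dF _ _ _ Fix Fjx) js in nis.
Qed.

Lemma bigsetUP (I : finType) (Q : pred I) (F : I -> set T) x :
  (\big[setU/set0]_(i | Q i) F i) x <-> exists2 i, Q i & F i x.
Proof.
rewrite -bigcup_seq_cond; split=> [[i /= /andP[_ Qi] Fi]|[i Qi Fi]]; first by exists i.
by exists i => //=; rewrite mem_index_enum.
Qed.

Section Conditional.
Variable E : set T.
Hypotheses (mE : measurable E) (E0 : 0 < pr E).
Local Notation Q A := (condP P E A).

Lemma condP_ge0 A : 0 <= Q A.
Proof. by rewrite /condP divr_ge0 // pr_ge0. Qed.

Lemma condP_le A B : measurable A -> measurable B -> A `<=` B -> Q A <= Q B.
Proof.
move=> mA mB AB; rewrite /condP ler_pM2r ?invr_gt0 //.
by apply: pr_le; [exact: measurableI|exact: measurableI|exact: setSI].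
Qed.

Lemma condPU A B : measurable A -> measurable B -> A `&` B = set0 ->
  Q (A `|` B) = Q A + Q B.
Proof.
move=> mA mB AB; rewrite /condP setIUl prU ?mulrDl //; try exact: measurableI.
by rewrite setIACA AB set0I.
Qed.

Lemma condPT : Q setT = 1.
Proof. by rewrite /condP setTI divff // gt_eqF. Qed.

End Conditional.
End FiniteProbability.

(** * The three-valued lower bound for one coordinate and its law *)

Section CoarseSign.
Context {R : realType}.
Implicit Types v t : R.

(** [Some true], [None] and [Some false] stand for the values 1, 0, -1. A finite type of outcomes
    turns events about all coordinates into finite unions of patterns. *)
Definition coarse_sign v t : option bool :=
  if 0 <= v then
    if t <= 0 then Some true else if t <= v / 2 then None else Some false
  else
    if 0 <= t then Some true else if v / 2 <= t then None else Some false.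

Definition sign_val (o : option bool) : R :=
  match o with Some true => 1 | None => 0 | Some false => -1 end.

(** If t and v do not share a strict sign, the right side is exactly |v|. If t lies between 0 and
    v/2, it is |v| - 2|t| >= 0. Otherwise the triangle inequality gives -|v|. *)
Lemma coarse_sign_le v t :
  `|v| * sign_val (coarse_sign v t) <= `|v - t| - `|t|.
Proof.
have h1 := ler_norm (v - t); have h2 := ler_norm (t - v).
rewrite distrC in h2; rewrite /coarse_sign; case: (leP 0 v) => v0.
  rewrite (ger0_norm v0); case: (leP t 0) => t0.
    by rewrite (ler0_norm t0) /=; lra.
  by rewrite (gtr0_norm t0); case: (leP t (v / 2)) => tv /=; lra.
rewrite (ltr0_norm v0); case: (leP 0 t) => t0.
  by rewrite (ger0_norm t0) /=; lra.
by rewrite (ltr0_norm t0); case: (leP (v / 2) t) => tv /=; lra.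
Qed.

Definition coarse_itv v (o : option bool) : interval R :=
  if 0 <= v then
    match o with
    | Some true => `]-oo, 0]%R | None => `]0, v / 2]%R | Some false => `]v / 2, +oo[%R
    end
  else
    match o with
    | Some true => `[0, +oo[%R | None => `[v / 2, 0[%R | Some false => `]-oo, v / 2[%R
    end.

Lemma coarse_signE v o : [set t | coarse_sign v t = o] = [set` coarse_itv v o].
Proof.
apply/seteqP; split => t /=; rewrite /coarse_sign /coarse_itv; case: (leP 0 v) => v0.
- by case: (leP t 0) => t0; [|case: (leP t (v / 2)) => tv] => <-; rewrite in_itv /= ?t0 ?tv.
- by case: (leP 0 t) => t0; [|case: (leP (v / 2) t) => tv] => <-; rewrite in_itv /= ?t0 ?tv.
- case: o => [[]|]; rewrite in_itv /= ?andbT.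
  + by move=> ->.
  + by move=> tv; rewrite !leNgt tv (_ : 0 < t) //; lra.
  + by case/andP=> t0 tv; rewrite leNgt t0 tv.
- case: o => [[]|]; rewrite in_itv /= ?andbT.
  + by move=> ->.
  + by move=> tv; rewrite !leNgt tv (_ : t < 0) //; lra.
  + by case/andP=> tv t0; rewrite leNgt t0 tv.
Qed.

Lemma measurable_coarse v o : measurable [set t : R | coarse_sign v t = o].
Proof. by rewrite coarse_signE; exact: measurable_itv. Qed.

End CoarseSign.

Section CoarseLaw.
Context {d0 : measure_display} {T : measurableType d0} {R : realType} (P : probability T R).
Variables (E : set T) (u : T -> R) (v : R).
Hypotheses (mE : measurable E) (E0 : 0 < fine (P E)) (mu : measurable_fun setT u).

Definition coarse_law (o : option bool) : R :=
  condP P E (u @^-1` [set t | coarse_sign v t = o]).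

Let mpre (B : set R) : measurable B -> measurable (u @^-1` B).
Proof. by move=> mB; rewrite -[X in measurable X]setTI; exact: mu. Qed.

Lemma coarse_law_ge0 o : 0 <= coarse_law o.
Proof. exact: condP_ge0. Qed.

Let mlaw o : measurable (u @^-1` [set t | coarse_sign v t = o]).
Proof. by apply: mpre; exact: measurable_coarse. Qed.

Let mnlaw : measurable (u @^-1` [set t | coarse_sign v t <> Some true]).
Proof. by apply: mpre; exact: (measurableC (measurable_coarse v (Some true))). Qed.

Let law2 : coarse_law None + coarse_law (Some false) =
  condP P E (u @^-1` [set t | coarse_sign v t <> Some true]).
Proof.
rewrite /coarse_law -condPU //; last first.
  by apply/seteqP; split => // x /= [-> //].
congr (condP P E _); apply/seteqP; split => x /=; first by case=> ->.
by case: coarse_sign => [[]|] //; [right|left].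
Qed.

Lemma coarse_law_sum1 :
  coarse_law (Some true) + coarse_law None + coarse_law (Some false) = 1.
Proof.
rewrite -addrA law2 /coarse_law -condPU //.
- rewrite -(condPT P _ E0); congr (condP P E _); apply/seteqP; split => // x _ /=.
  by case: coarse_sign => [[]|]; [left|right|right].
- by apply/seteqP; split => // x /= [-> //].
Qed.

(** For v >= 0, [Some true] is the event u <= 0, and the other outcomes lie in u >= 0; for v < 0 the
    roles swap. A possible atom at 0 is thus counted on the favourable side. *)
Lemma coarse_law_balance :
  condP P E [set w | u w <= 0] = condP P E [set w | u w >= 0] ->
  coarse_law None + coarse_law (Some false) <= coarse_law (Some true).
Proof.
move=> sym.
have mle : measurable [set w | u w <= 0].
  by rewrite -[X in measurable X]/(u @^-1` [set t | t <= 0]) -set_itvNyc;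
    apply: mpre; exact: measurable_itv.
have mge : measurable [set w | 0 <= u w].
  by rewrite -[X in measurable X]/(u @^-1` [set t | 0 <= t]) -set_itvcy;
    apply: mpre; exact: measurable_itv.
rewrite law2; case: (leP 0 v) => v0.
  apply: (@le_trans _ _ (condP P E [set w | u w >= 0])).
    apply: condP_le => //.
    by move=> x /=; rewrite /coarse_sign v0; case: leP => // /ltW.
  rewrite -sym; apply: condP_le => //.
  by move=> x /= ux; rewrite /coarse_sign v0 ux.
apply: (@le_trans _ _ (condP P E [set w | u w <= 0])).
  apply: condP_le => //.
  by move=> x /=; rewrite /coarse_sign leNgt v0 /=; case: leP => // /ltW.
rewrite sym; apply: condP_le => //.
by move=> x /= ux; rewrite /coarse_sign leNgt v0 /= ux.
Qed.

(** The interval for [None] has length |v|/2 and lies in [-1, 1], where the density is at least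
    1/10. *)
Lemma coarse_law_density (p : R -> R) :
  measurable_fun setT p -> (forall t, 0 <= p t) ->
  (forall B, measurable B -> (condP P E (u @^-1` B))%:E =
     (\int[lebesgue_measure]_(t in B) (p t)%:E)%E) ->
  (forall t, -1 <= t <= 1 -> 1 / 10 <= p t) -> `|v| <= 1 ->
  `|v| / 20 <= coarse_law None.
Proof.
move=> mp p0 dens p1 v1.
have mB := measurable_coarse v None.
rewrite -lee_fin /coarse_law dens //.
have -> : (`|v| / 20)%:E = (\int[lebesgue_measure]_(t in [set t | coarse_sign v t = None]) (1 / 10)%:E)%E.
  rewrite integral_cst // coarse_signE /coarse_itv.
  case: (leP 0 v) => v0 /=; rewrite lebesgue_measure_itv /= lte_fin.
    rewrite (ger0_norm v0); case: ltP => v2; last first.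
      by rewrite mule0; congr (_%:E); lra.
    by rewrite -EFinB -EFinM; congr (_%:E); lra.
  rewrite (ltr0_norm v0) (_ : v / 2 < 0); last by lra.
  by rewrite -EFinB -EFinM; congr (_%:E); lra.
apply: ge0_le_integral => //.
- by apply/measurable_EFinP; apply: measurable_funTS.
- move=> t; rewrite coarse_signE /= => tB; rewrite lee_fin; apply: p1.
  move: tB v1; rewrite /coarse_itv; case: (leP 0 v) => v0; rewrite in_itv /=.
    by rewrite (ger0_norm v0); lra.
  by rewrite (ltr0_norm v0); lra.
Qed.

End CoarseLaw.

Lemma sum_option_bool {V : nmodType} (f : option bool -> V) :
  \sum_o f o = f (Some true) + f None + f (Some false).
Proof.
rewrite (bigD1 (Some true)) //= (bigD1 None) //= (bigD1 (Some false)) //=.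
by rewrite big1 ?addr0 ?addrA // => -[[]|].
Qed.

(** * The Chernoff bound conditionally on one value of the random subset *)

Section Chernoff.
Context {d0 : measure_display} {T : measurableType d0} {R : realType} (P : probability T R).
Context {n : nat} (eta : 'I_n -> T -> R) (v : 'cV[R]_n).
Hypothesis meta : forall i, measurable_fun setT (eta i).

(** The threshold 1 is 1/2 for the Huber smoothing plus 1/2 for rounding to the net. *)
Definition small_sum : set T :=
  [set w | \sum_i `|v i 0| * sign_val (coarse_sign (v i 0) (eta i w)) <= 1 :> R].

Let pattern (z : {ffun 'I_n -> option bool}) : set T :=
  [set w | forall i, coarse_sign (v i 0) (eta i w) = z i].

Let mpattern z : measurable (pattern z).
Proof.
rewrite (_ : pattern z = \bigcap_(i in [set: 'I_n])
    (eta i @^-1` [set t | coarse_sign (v i 0) t = z i])).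
  apply: fin_bigcap_measurable => [|i _]; first exact: finite_finset.
  rewrite -[X in measurable X]setTI; apply: meta => //; exact: measurable_coarse.
by apply/seteqP; split => w /= h i => [_|]; apply: h.
Qed.

Let small_sumE : small_sum = \big[setU/set0]_(z : {ffun 'I_n -> option bool} |
  \sum_i `|v i 0| * sign_val (z i) <= 1) pattern z.
Proof.
apply/seteqP; split=> w.
  rewrite /small_sum /= => h; apply/bigsetUP.
  exists [ffun i => coarse_sign (v i 0) (eta i w)]; last by move=> i; rewrite ffunE.
  by under eq_bigr do rewrite ffunE.
move=> /bigsetUP[z h pz]; rewrite /small_sum /=.
by under eq_bigr do rewrite pz.
Qed.

Lemma measurable_small_sum : measurable small_sum.
Proof. by rewrite small_sumE; apply: bigsetU_measurable. Qed.

Variable E : set T.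
Hypotheses (mE : measurable E) (E0 : 0 < fine (P E)).
Hypothesis indep : forall B : 'I_n -> set R, (forall i, measurable (B i)) ->
  condP P E [set w | forall i, B i (eta i w)] = \prod_i condP P E (eta i @^-1` B i).

(** Markov's inequality for an exponential, written as a finite sum over sign patterns. Independence
    factorizes the probability of a pattern, and a pattern with weighted sum at most 1 has
    exponential factor at least 1. *)
Lemma chernoff_small_sum (lam : R) : 0 <= lam ->
  fine (P (small_sum `&` E)) <= fine (P E) * (expR lam *
    \prod_i \sum_o coarse_law P E (eta i) (v i 0) o * expR (- (lam * `|v i 0| * sign_val o))).
Proof.
move=> lam0; pose law i o := coarse_law P E (eta i) (v i 0) o.
pose Q (z : {ffun 'I_n -> option bool}) : bool := \sum_i `|v i 0| * sign_val (z i) <= 1 :> R.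
have prpattern z : fine (P (pattern z `&` E)) = fine (P E) * \prod_i law i (z i).
  rewrite /law /coarse_law -indep; last by move=> i; exact: measurable_coarse.
  by rewrite /condP mulrC divfK // gt_eqF.
apply: (@le_trans _ _ (\sum_(z | Q z) fine (P (pattern z `&` E)))).
  have mI z : measurable (pattern z `&` E) by exact: measurableI.
  apply: le_trans (pr_bigsetU_le P _ Q _ mI).
  apply: pr_le; [exact: measurableI measurable_small_sum mE| |].
    exact: bigsetU_measurable.
  move=> w []; rewrite {1}small_sumE => /bigsetUP[z Qz pz] Ew.
  by apply/bigsetUP; exists z.
(* Expand the product of the generating functions into a sum over all patterns; those outside [Q]
   contribute nonnegative terms and are dropped. *)
rewrite bigA_distr_bigA /= !big_distrr /= [leRHS](bigID Q) /=.
have term0 z : 0 <= fine (P E) * (expR lam *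
    \prod_i (law i (z i) * expR (- (lam * `|v i 0| * sign_val (z i))))).
  rewrite mulr_ge0 ?(ltW E0) // mulr_ge0 ?expR_ge0 //.
  by apply: prodr_ge0 => i _; rewrite mulr_ge0 ?expR_ge0 // coarse_law_ge0.
rewrite -[leLHS]addr0; apply: lerD; last by apply: sumr_ge0 => z _; exact: term0.
apply: ler_sum => z Qz; rewrite prpattern ler_pM2l //.
rewrite [X in _ <= _ * X]big_split /= [leRHS]mulrCA ler_peMr //.
  by apply: prodr_ge0 => i _; exact: coarse_law_ge0.
rewrite -expR_sum -exp.expRD -exp.expR0 ler_expR sumrN.
rewrite (eq_bigr (fun i => lam * (`|v i 0| * sign_val (z i)))); last by move=> i _; rewrite mulrA.
by rewrite -big_distrr /= -{1}[lam]mulr1 -mulrBr mulr_ge0 // subr_ge0.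
Qed.
End Chernoff.

(** * Generating function of one coordinate, with and without the density bound *)

Section CoordinateMGF.
Context {d0 : measure_display} {T : measurableType d0} {R : realType} (P : probability T R).
Variables (E : set T) (u : T -> R) (v lam : R).
Hypotheses (mE : measurable E) (E0 : 0 < fine (P E)) (mu : measurable_fun setT u).
Hypothesis sym : condP P E [set w | u w <= 0] = condP P E [set w | u w >= 0].
Hypothesis lam0 : 0 <= lam <= 1 / 2.
Local Notation mgf :=
  (\sum_o coarse_law P E u v o * expR (- (lam * `|v| * sign_val o))).

Let mgfE : mgf = coarse_law P E u v (Some true) * expR (- (lam * `|v|)) +
  coarse_law P E u v None + coarse_law P E u v (Some false) * expR (lam * `|v|).
Proof.
by rewrite sum_option_bool /= mulr1 mulr0 oppr0 exp.expR0 mulr1 mulrN1 opprK.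
Qed.

Lemma coarse_mgf_le : mgf <= expR (2 * lam ^+ 2 * v ^+ 2).
Proof.
rewrite mgfE; have bal := coarse_law_balance _ _ _ v mE E0 mu sym.
have p0 := coarse_law_ge0 P E u v.
rewrite -[v ^+ 2]real_normK ?num_real // -mulrA -exprMn.
apply: mgf_sign_le => //; first by case/andP: lam0 => l0 _; rewrite mulr_ge0.
  exact: coarse_law_sum1.
by have := p0 None; lra.
Qed.

Lemma coarse_mgf_le_drift (p : R -> R) :
  measurable_fun setT p -> (forall t, 0 <= p t) ->
  (forall B, measurable B -> (condP P E (u @^-1` B))%:E =
     (\int[lebesgue_measure]_(t in B) (p t)%:E)%E) ->
  (forall t, -1 <= t <= 1 -> 1 / 10 <= p t) -> `|v| <= 1 ->
  mgf <= expR (2 * lam ^+ 2 * v ^+ 2) * expR (- (lam * v ^+ 2 / 40)).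
Proof.
move=> mp pp dens p1 v1.
have none := coarse_law_density P E u v p mp pp dens p1 v1.
rewrite mgfE; have bal := coarse_law_balance _ _ _ v mE E0 mu sym.
have p0 := coarse_law_ge0 P E u v.
have -> : expR (2 * lam ^+ 2 * v ^+ 2) * expR (- (lam * v ^+ 2 / 40)) =
   expR (2 * (lam * `|v|) ^+ 2 - (`|v| / 20) * (lam * `|v|) / 2).
  rewrite -exp.expRD; congr expR; rewrite -[v ^+ 2]real_normK ?num_real //; by field.
case/andP: lam0 => l0 l1; have v0 := normr_ge0 v.
apply: mgf_sign_le_drift => //.
- by apply/andP; split; nra.
- exact: coarse_law_sum1.
- by apply/andP; split; have := p0 (Some false); lra.
Qed.
End CoordinateMGF.

(** * Averaging the Chernoff bound over the random subset *)

Section RandomSubset.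
Context {d0 : measure_display} {T : measurableType d0} {R : realType} (P : probability T R).
Context {n k : nat} {alpha : R} {Rset : T -> {set 'I_n}} {eta : 'I_n -> T -> R}.
Hypotheses (n0 : (0 < n)%N) (kn : (k <= n)%N) (alphaE : alpha * n%:R = k%:R).
Hypothesis meta : forall i, measurable_fun setT (eta i).
Hypothesis mRset : forall S : {set 'I_n}, measurable [set w | Rset w = S].
Hypothesis unif : forall S : {set 'I_n}, #|S| = k ->
  fine (P [set w | Rset w = S]) = 1 / 'C(n, k)%:R.
Hypothesis indep : forall S : {set 'I_n}, #|S| = k ->
  forall B : 'I_n -> set R, (forall i, measurable (B i)) ->
    condP P [set w | Rset w = S] [set w | forall i, B i (eta i w)] =
    \prod_i condP P [set w | Rset w = S] (eta i @^-1` B i).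
Hypothesis sym : forall S : {set 'I_n}, #|S| = k -> forall i,
  condP P [set w | Rset w = S] [set w | eta i w <= 0] =
  condP P [set w | Rset w = S] [set w | eta i w >= 0].
Hypothesis dens : forall S : {set 'I_n}, #|S| = k -> forall i, i \in S ->
  exists p : R -> R,
    measurable_fun setT p /\ (forall t, 0 <= p t) /\
    (forall B, measurable B ->
       (condP P [set w | Rset w = S] (eta i @^-1` B))%:E =
       (\int[lebesgue_measure]_(t in B) (p t)%:E)%E) /\
    (forall t, -1 <= t <= 1 -> 1 / 10 <= p t).

Let binR0 : 0 < 'C(n, k)%:R :> R.
Proof. by rewrite ltr0n bin_gt0. Qed.

(** The binomially many subsets of size k, of equal mass, exhaust the probability, so all other
    sizes together have mass 0. *)
Lemma pr_uniform_support :
  fine (P (\big[setU/set0]_(S : {set 'I_n} | #|S| == k) [set w | Rset w = S])) = 1.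
Proof.
rewrite pr_bigsetU //; last by move=> S S' w /= <-.
rewrite (eq_bigr (fun=> 1 / 'C(n, k)%:R)); last by move=> S /eqP /unif.
rewrite sumr_const -[X in _ *+ X](_ : 'C(n, k) = _).
  by rewrite -[LHS]mulr_natr div1r mulVf // gt_eqF.
by rewrite -{1}(card_ord n) -card_draws cardsE.
Qed.

(** Given the subset S, the Chernoff bound has an extra factor [c i] for each i in S. Averaging over
    S by comparison with independent sampling turns these into factors 1 - alpha (1 - c i), at the
    price n+1. *)
Lemma pr_small_sum_le (v : 'cV[R]_n) (lam : R) : 0 <= lam <= 1 / 2 ->
  fine (P (small_sum eta v)) <=
  expR lam * expR (2 * lam ^+ 2 * \sum_i v i 0 ^+ 2) * n.+1%:R *
  expR (- (alpha * lam / 80 * \sum_(i | `|v i 0| <= 1) v i 0 ^+ 2)).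
Proof.
move=> lam01; have /andP[lam0 lam1] := lam01.
have mss := measurable_small_sum eta v meta.
pose D (S : {set 'I_n}) : set T := [set w | Rset w = S].
pose U := \big[setU/set0]_(S : {set 'I_n} | #|S| == k) D S.
have mU : measurable U by apply: bigsetU_measurable => S _; exact: mRset.
have D0 (S : {set 'I_n}) : #|S| = k -> 0 < fine (P (D S)) by move=> /unif ->; rewrite divr_gt0.
have mI (S : {set 'I_n}) : measurable (small_sum eta v `&` D S) by exact: measurableI mss (mRset S).
have split_le : fine (P (small_sum eta v)) <=
    \sum_(S : {set 'I_n} | #|S| == k) fine (P (small_sum eta v `&` D S)).
  pose V := \big[setU/set0]_(S : {set 'I_n} | #|S| == k) (small_sum eta v `&` D S).
  have mV : measurable V by apply: bigsetU_measurable => S _; exact: mI.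
  have mUC : measurable (~` U) by exact: measurableC.
  have cover : small_sum eta v `<=` V `|` ~` U.
    move=> w sw; have [Rk|Rk] := eqVneq #|Rset w| k.
      by left; apply/bigsetUP; exists (Rset w); rewrite ?Rk.
    by right => /bigsetUP[S Sk] /= RS; rewrite RS Sk in Rk.
  have h := le_trans (pr_le P _ _ mss (measurableU _ _ mV mUC) cover) (prU_le P _ _ mV mUC).
  rewrite pr_setC // pr_uniform_support subrr addr0 in h.
  by apply: le_trans h _; exact: pr_bigsetU_le.
apply: le_trans split_le _.
(* The drift gain of a coordinate in the subset; it is 1 when |v_i| > 1, where [coarse_law_density]
   does not apply. *)
pose c i := if `|v i 0| <= 1 then expR (- (lam * v i 0 ^+ 2 / 40)) else 1.
have c0 i : 0 <= c i by rewrite /c; case: ifP => // _; exact: expR_ge0.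
pose G := expR (2 * lam ^+ 2 * \sum_i v i 0 ^+ 2).
have GE : G = \prod_i expR (2 * lam ^+ 2 * v i 0 ^+ 2).
  by rewrite -expR_sum -big_distrr.
have bound (S : {set 'I_n}) : #|S| == k -> fine (P (small_sum eta v `&` D S)) <=
    1 / 'C(n, k)%:R * (expR lam * (G * \prod_(i in S) c i)).
  move=> /eqP Sk.
  have := chernoff_small_sum P eta v meta (D S) (mRset S) (D0 S Sk) (indep S Sk) lam lam0.
  move=> /le_trans; apply; rewrite /D unif // ler_wpM2l ?divr_ge0 // ler_wpM2l ?expR_ge0 //.
  rewrite (big_mkcond (mem S)) /= GE -big_split /=.
  apply: ler_prod => i _; apply/andP; split.
    by apply: sumr_ge0 => o _; rewrite mulr_ge0 ?expR_ge0 // coarse_law_ge0.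
  have mgf := coarse_mgf_le P (D S) (eta i) (v i 0) lam (mRset S) (D0 S Sk) (meta i) (sym S Sk i) lam01.
  case: ifP => iS; last by rewrite mulr1.
  rewrite /c; case: ifP => vi; last by rewrite mulr1.
  have [p [mp [pp [pd p1]]]] := dens S Sk i iS.
  exact: (coarse_mgf_le_drift P (D S) (eta i) (v i 0) lam (mRset S) (D0 S Sk) (meta i)
    (sym S Sk i) lam01 p mp pp pd p1 vi).
apply: le_trans (ler_sum _ bound) _.
rewrite -!big_distrr /=.
have esum := sum_subset_prod_le _ _ c n0 kn c0.
have pE : k%:R / n%:R = alpha by rewrite -alphaE mulfK // pnatr_eq0 -lt0n.
rewrite pE in esum.
have alpha01 : 0 <= alpha <= 1.
  rewrite -pE divr_ge0 //= ler_pdivrMr ?ltr0n // mul1r ler_nat //.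
(* From exp(-x) <= 1 - x/2 at x = lam v_i^2/40 one gets 1 - c_i >= lam v_i^2/80; then 1 - z <=
   exp(-z). *)
have prodle : \prod_i (1 - alpha * (1 - c i)) <=
    expR (- (alpha * lam / 80 * \sum_(i | `|v i 0| <= 1) v i 0 ^+ 2)).
  rewrite [X in _ * X]big_mkcond big_distrr /= -sumrN expR_sum; apply: ler_prod => i _.
  have /andP[a0 a1] := alpha01; have ci := c0 i; apply/andP; split; first by nra.
  apply: le_trans (expR_ge1Dx _); rewrite lerD2l lerN2 /c.
  case: ifP => vi; last by rewrite mulr0 subrr mulr0.
  have v2 : v i 0 ^+ 2 <= 1.
    by rewrite -[v i 0 ^+ 2]real_normK ?num_real // expr_le1.
  have v20 := sqr_ge0 (v i 0).
  have h := @expRN_le_half _ (lam * v i 0 ^+ 2 / 40).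
  have {}h : expR (- (lam * v i 0 ^+ 2 / 40)) <= 1 - lam * v i 0 ^+ 2 / 40 / 2.
    by apply: h; apply/andP; split; nra.
  rewrite [leLHS](_ : _ = alpha * (lam * v i 0 ^+ 2 / 80)); last by field.
  apply: ler_wpM2l => //; lra.
have esum2 := le_trans esum (ler_wpM2l (mulr_ge0 (ler0n _ _) (ler0n _ _)) prodle).
rewrite -/G; set W := expR (- _) in esum2 *; set s := \sum_(S | _) _ in esum2 *.
rewrite [leRHS](_ : _ = 1 / 'C(n, k)%:R * (expR lam * (G * ('C(n, k)%:R * n.+1%:R * W)))).
  by rewrite !ler_wpM2l ?expR_ge0 // divr_ge0.
by field; rewrite gt_eqF.
Qed.

End RandomSubset.

(** * Deterministic facts on the Huber loss and on spread subspaces *)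

Section Huber.
Context {R : realType}.

Lemma Phi_le_norm (h t : R) : 0 < h -> Phi h t <= `|t|.
Proof.
move=> h0; rewrite /Phi; case: ifP => [th|_]; last by lra.
rewrite -[t ^+ 2]real_normK ?num_real // ler_pdivrMr; last by lra.
have := normr_ge0 t; nra.
Qed.

Lemma norm_le_Phi (h t : R) : 0 < h -> `|t| - h / 2 <= Phi h t.
Proof.
move=> h0; rewrite /Phi; case: ifP => [th|_]; last by lra.
rewrite -[t ^+ 2]real_normK ?num_real // ler_pdivlMr; last by lra.
have := sqr_ge0 (`|t| - h); nra.
Qed.

Lemma vnorm_sqr n (v : 'cV[R]_n) : vnorm v ^+ 2 = \sum_i v i 0 ^+ 2.
Proof. by rewrite /vnorm sqr_sqrtr // sumr_ge0 // => i _; exact: sqr_ge0. Qed.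

(** Compare [b] with [bstar]. Replacing the Huber loss by the absolute value costs at most h/2 per
    coordinate, in total nh/2 = 1/2. *)
Lemma minimizer_l1_gap n d (X : 'M[R]_(n, d)) (bstar b : 'cV[R]_d) (eta : 'cV[R]_n) :
  (0 < n)%N -> is_minimizer (1 / n%:R) X (X *m bstar + eta) b ->
  \sum_i (`|(X *m (b - bstar)) i 0 - eta i 0| - `|eta i 0|) <= 1 / 2.
Proof.
move=> n0 /(_ bstar); rewrite /fh; set h := 1 / n%:R.
have nR : 0 < n%:R :> R by rewrite ltr0n.
have h0 : 0 < h by rewrite divr_gt0.
move=> le_fh.
have {le_fh} : \sum_(i < n) (`|(X *m (b - bstar)) i 0 - eta i 0| - h / 2) <= \sum_i `|eta i 0|.
  apply: le_trans (le_trans _ le_fh) _; apply: ler_sum => i _.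
    apply: le_trans (norm_le_Phi _ _ h0).
    by rewrite lerD2r mulmxBr !mxE; rewrite le_eqVlt; apply/orP; left; apply/eqP; congr `|_|; ring.
  apply: le_trans (Phi_le_norm _ _ h0) _.
  by rewrite !mxE opprD addrA subrr add0r normrN.
rewrite !sumrB sumr_const card_ord -[_ *+ n]mulr_natr /h.
rewrite (_ : 1 / n%:R / 2 * n%:R = 1 / 2); last by field; rewrite gt_eqF.
lra.
Qed.

(** Convexity in v, as the gap vanishes at v = 0. *)
Lemma l1_gap_scale n (v eta : 'cV[R]_n) (t : R) : 0 <= t <= 1 ->
  \sum_i (`|(t *: v) i 0 - eta i 0| - `|eta i 0|) <=
  t * \sum_i (`|v i 0 - eta i 0| - `|eta i 0|).
Proof.
move=> /andP[t0 t1]; rewrite big_distrr /=; apply: ler_sum => i _.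
rewrite mxE [X in `|X| - _](_ : _ = t * (v i 0 - eta i 0) - (1 - t) * eta i 0); last by ring.
have := ler_normB (t * (v i 0 - eta i 0)) ((1 - t) * eta i 0).
rewrite !normrM (ger0_norm t0) (ger0_norm (_ : 0 <= 1 - t)); last by lra.
move=> h; lra.
Qed.

(** At most m coordinates exceed 1 in absolute value, since the squares add up to m. The spread
    condition for the remaining ones, squared, leaves them a quarter of the mass. *)
Lemma spread_light_mass n (V : set 'cV[R]_n) (m : R) (v : 'cV[R]_n) :
  spread V m (1 / 2) -> V v -> \sum_i v i 0 ^+ 2 = m ->
  m / 4 <= \sum_(i | `|v i 0| <= 1) v i 0 ^+ 2.
Proof.
move=> sp Vv vm; pose S : {set 'I_n} := [set i | `|v i 0| <= 1]%SET.
have cS : #|~: S|%:R <= m.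
  rewrite -vm -sumr_const [leRHS](bigID (mem (~: S))) /=.
  rewrite -[leLHS]addr0; apply: lerD; last by apply: sumr_ge0 => i _; exact: sqr_ge0.
  apply: ler_sum => i; rewrite !inE -ltNge => /ltW vi.
  by rewrite -[v i 0 ^+ 2]real_normK ?num_real // expr_ge1.
have := sp v Vv S.
have -> : (n%:R - m <= #|S|%:R).
  by rewrite -[X in X%:R - _](card_ord n) -(cardsC S) natrD; lra.
move=> /(_ isT) h.
have m0 : 0 <= vnorm v by exact: sqrtr_ge0.
have : (1 / 2 * vnorm v) ^+ 2 <= vnorm_on S v ^+ 2.
  by rewrite ler_sqr ?nnegrE ?sqrtr_ge0 // mulr_ge0.
rewrite exprMn vnorm_sqr vm /vnorm_on sqr_sqrtr; last by apply: sumr_ge0 => i _; exact: sqr_ge0.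
rewrite (eq_bigl (fun i => `|v i 0| <= 1)); last by move=> i; rewrite inE.
lra.
Qed.

(** Here the empty set of coordinates is admissible in the spread condition. *)
Lemma spread_full_trivial n (V : set 'cV[R]_n) (m : R) (v : 'cV[R]_n) :
  spread V m (1 / 2) -> n%:R <= m -> V v -> vnorm v = 0.
Proof.
move=> sp nm Vv; have := sp v Vv finset.set0.
rewrite cards0 subr_le0 nm => /(_ isT).
rewrite /vnorm_on big_set0 sqrtr0 => h.
by apply/eqP; rewrite eq_le sqrtr_ge0 andbT; lra.
Qed.

End Huber.

(** * Choice of the Chernoff rate and count of the exponents *)

Lemma chernoff_rate_range {R : realType} (alpha : R) :
  0 < alpha < 1 -> 0 <= alpha / 1280 <= 1 / 2.
Proof.
move=> /andP[a0 a1]; rewrite divr_ge0 ?ler0n ?(ltW a0) //.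
rewrite ler_pdivrMr ?ltr0n // (le_trans (ltW a1)) //.
by rewrite mulrAC mul1r ler_pdivlMr ?ltr0n // mul1r ler_nat.
Qed.

(** With L = ln n, lam^2 m = 5dL. The exponents are at most 6dL for the net, L for exp(lam), 10dL
    for the quadratic term, 2L for n+1, and -20dL for the drift. Their sum is at most 3L - 4dL <=
    -dL. *)
Lemma net_failure_bound {R : realType} (n d : nat) (alpha m lam : R) :
  (2 <= n)%N -> (1 <= d)%N -> 0 < alpha < 1 ->
  alpha ^+ 2 * m = 5 * 1280 ^+ 2 * (d%:R * ln n%:R) ->
  lam = alpha / 1280 ->
  (n ^ (6 * d))%:R * (expR lam * expR (2 * lam ^+ 2 * m) * n.+1%:R *
    expR (- (alpha * lam / 80 * (m / 4)))) <= n%:R `^ (- (d%:R / 2)).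
Proof.
move=> n2 d1 /andP[a0 a1] mE lamE.
have N0 : 0 < n%:R :> R by rewrite ltr0n; lia.
have N2 : 2 <= n%:R :> R by rewrite ler_nat.
have D1 : 1 <= d%:R :> R by rewrite ler1n.
pose L : R := ln n%:R; rewrite -/L in mE.
have NL : n%:R = expR L by rewrite lnK // posrE.
have L0 : 0 <= L by rewrite ln_ge0 //; lra.
have e1 : expR lam <= expR L.
  rewrite -NL; apply: le_trans N2.
  have lam_half : lam <= 1 / 2.
    by rewrite lamE; have /andP[] := @chernoff_rate_range _ alpha (introT andP (conj a0 a1)).
  rewrite -[leLHS]mulr1 -ler_pdivlMl ?expR_gt0 // -expRN.
  apply: le_trans (_ : (1 - lam) * 2 <= _); first by lra.
  by rewrite ler_wpM2r // expR_ge1Dx.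
have e2 : n.+1%:R <= expR (2 * L).
  rewrite expRM_natl -NL -natr1; nra.
have e3 : (n ^ (6 * d))%:R = expR (6 * d%:R * L).
  by rewrite natrX NL -expRM_natl natrM.
have -> : n%:R `^ (- (d%:R / 2)) = expR (- (d%:R / 2) * L) :> R.
  by rewrite /powR gt_eqF.
rewrite e3.
apply: (@le_trans _ _ (expR (6 * d%:R * L) * (expR L * expR (2 * lam ^+ 2 * m) *
   expR (2 * L) * expR (- (alpha * lam / 80 * (m / 4)))))).
  rewrite ler_wpM2l ?expR_ge0 // ler_wpM2r ?expR_ge0 //.
  by rewrite ler_pM ?mulr_ge0 ?expR_ge0 // ler_wpM2r ?expR_ge0.
rewrite -!exp.expRD ler_expR.
have c0 : 1280 != 0 :> R by rewrite pnatr_eq0.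
have aE : alpha = 1280 * lam by rewrite lamE mulrC (divfK c0).
have lm : lam ^+ 2 * m = 5 * (d%:R * L).
  apply: (mulfI (expf_neq0 2 c0)) => /=.
  rewrite [LHS]mulrA -exprMn -aE mE [RHS]mulrA.
  by congr (_ * _); rewrite mulrC.
have -> : 2 * lam ^+ 2 * m = 10 * (d%:R * L) by rewrite -mulrA lm; ring.
have -> : alpha * lam / 80 * (m / 4) = 20 * (d%:R * L).
  have c320 : 1280 = 80 * 16 :> R by rewrite -natrM.
  rewrite aE c320 (_ : 80 * 16 * lam * lam / 80 * (m / 4) = 4 * (lam ^+ 2 * m)); last by field.
  by rewrite lm; ring.
have : L <= d%:R * L by rewrite ler_peMl.
lra.
Qed.

(** * From a minimizer with large error to a failing net point *)

Section Recovery.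
Context {R : realType} {n d : nat} (X : 'M[R]_(n, d)) (m : R).
Hypotheses (n2 : (2 <= n)%N) (m0 : 0 < m) (mn : m < n%:R).

Let sphere : set 'cV[R]_n := [set v | colspan X v /\ \sum_i v i 0 ^+ 2 = m].

Lemma colspan_sphere_net : exists (I : finType) (g : I -> 'cV[R]_n),
  [/\ (#|I| <= n ^ (6 * d))%N, forall a, sphere (g a) &
    forall v, sphere v -> exists a, forall i, `|v i 0 - g a i 0| <= (2 * n%:R)^-1].
Proof.
apply: (colspan_net _ _ X sphere n2); first by move=> v [].
move=> v [_ vm] i.
have n1 : 1 <= n%:R :> R by rewrite ler1n; lia.
have : v i 0 ^+ 2 <= n%:R ^+ 2.
  apply: (@le_trans _ _ m); last by rewrite (le_trans (ltW mn)) // expr2 ler_peMl.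
  rewrite -vm (bigD1 i) //= lerDl; apply: sumr_ge0 => j _; exact: sqr_ge0.
by rewrite -[v i 0 ^+ 2]real_normK ?num_real // ler_sqr ?nnegrE //; lra.
Qed.

(** Shrinking the error vector to the sphere keeps the gap at most 1/2. Rounding to the net moves
    each of the n coordinates by at most 1/(2n), which adds at most 1/2. *)
Lemma far_minimizer_small_sum (I : finType) (g : I -> 'cV[R]_n)
    (bstar b : 'cV[R]_d) (e : 'I_n -> R) :
  (forall v, sphere v -> exists a, forall i, `|v i 0 - g a i 0| <= (2 * n%:R)^-1) ->
  is_minimizer (1 / n%:R) X (X *m bstar + \col_i e i) b ->
  m < vnorm (X *m (b - bstar)) ^+ 2 ->
  exists a, \sum_i `|g a i 0| * sign_val (coarse_sign (g a i 0) (e i)) <= 1.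
Proof.
move=> net minb far; set u := X *m (b - bstar) in far.
have N0 : 0 < n%:R :> R by rewrite ltr0n; lia.
have gap := minimizer_l1_gap _ _ _ _ _ _ (ltnW n2) minb.
rewrite -/u in gap.
have u0 : 0 < vnorm u ^+ 2 by apply: lt_trans far.
pose t := Num.sqrt (m / vnorm u ^+ 2).
have t2 : t ^+ 2 = m / vnorm u ^+ 2 by rewrite sqr_sqrtr // divr_ge0 ?ltW.
have t0 : 0 <= t by exact: sqrtr_ge0.
have t1 : t <= 1.
  by rewrite -[leRHS]sqrtr1; apply: ler_wsqrtr; rewrite ler_pdivrMr // mul1r ltW.
have Ks : sphere (t *: u).
  split; first by exists (t *: (b - bstar)); rewrite -scalemxAr.
  under eq_bigr do rewrite mxE exprMn.
  by rewrite -big_distrr /= -vnorm_sqr t2 divfK // gt_eqF.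
have [a close] := net _ Ks; exists a.
have scale := l1_gap_scale _ u (\col_i e i) t _.
have {scale} := scale (introT andP (conj t0 t1)).
have le1 : \sum_i `|g a i 0| * sign_val (coarse_sign (g a i 0) (e i)) <=
    \sum_i (`|(t *: u) i 0 - (\col_i e i) i 0| - `|(\col_i e i) i 0| + (2 * n%:R)^-1).
  apply: ler_sum => i _; apply: le_trans (coarse_sign_le _ _) _.
  rewrite [(\col_i e i) i 0]mxE.
  have := close i; rewrite distrC => ci.
  have := ler_normD (g a i 0 - (t *: u) i 0) ((t *: u) i 0 - e i).
  by rewrite addrA subrK; lra.
rewrite big_split /= sumr_const card_ord -[_ *+ n]mulr_natr in le1.
have nn : (2 * n%:R)^-1 * n%:R = 1 / 2 :> R by field; rewrite gt_eqF.
rewrite nn in le1.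
move=> h; apply: le_trans le1 _.
have : t * \sum_i (`|u i 0 - (\col_i e i) i 0| - `|(\col_i e i) i 0|) <= 1 / 2.
  set s := \sum_i _ in gap *; nra.
lra.
Qed.

End Recovery.

(** * The recovery guarantee, by a union bound over the net *)

Theorem mainTheorem3 :
  exists C C' : RR, 0 < C /\ 0 < C' /\
  forall (n d k : nat) (alpha : RR)
    (X : 'M[RR]_(n, d)) (beta_star : 'cV[RR]_d)
    (d0 : measure_display) (T : measurableType d0)
    (P : probability T RR)
    (Rset : T -> {set 'I_n}) (eta : 'I_n -> T -> RR),
  (2 <= n)%N -> (1 <= d)%N ->
  0 < alpha < 1 -> alpha * n%:R = k%:R ->
  (* eta is a random vector *)
  (forall i, measurable_fun setT (eta i)) ->
  (* Rset is a random subset, uniform among subsets of size alpha n *)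
  (forall S : {set 'I_n}, measurable [set w | Rset w = S]) ->
  (forall S : {set 'I_n}, #|S| = k ->
     fine (P [set w | Rset w = S]) = 1 / 'C(n, k)%:R) ->
  (* (1) conditional mutual independence given Rset *)
  (forall S : {set 'I_n}, #|S| = k ->
     forall B : 'I_n -> set RR, (forall i, measurable (B i)) ->
       condP P [set w | Rset w = S] [set w | forall i, B i (eta i w)] =
       \prod_i condP P [set w | Rset w = S] (eta i @^-1` B i)) ->
  (* (2) conditional symmetry of signs *)
  (forall S : {set 'I_n}, #|S| = k -> forall i,
     condP P [set w | Rset w = S] [set w | eta i w <= 0] =
     condP P [set w | Rset w = S] [set w | eta i w >= 0]) ->
  (* (3) conditional densities bounded below on [-1,1] for i in Rset *)
  (forall S : {set 'I_n}, #|S| = k -> forall i, i \in S ->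
     exists p : RR -> RR,
       measurable_fun setT p /\ (forall t, 0 <= p t) /\
       (forall B, measurable B ->
          (condP P [set w | Rset w = S] (eta i @^-1` B))%:E =
          (\int[lebesgue_measure]_(t in B) (p t)%:E)%E) /\
       (forall t, -1 <= t <= 1 -> 1 / 10 <= p t)) ->
  let delta := C * (d%:R * ln n%:R / (alpha ^+ 2 * n%:R)) in
  spread (colspan X) (delta * n%:R) (1 / 2) ->
  let h := 1 / n%:R in
  let y := fun w => X *m beta_star + \col_i eta i w in
  exists E : set T, measurable E /\
    (forall w, E w -> forall bhat, is_minimizer h X (y w) bhat ->
       (vnorm (X *m (bhat - beta_star))) ^+ 2 / n%:R <= delta) /\
    1 - C' * (n%:R `^ (- (d%:R / 2))) <= fine (P E).
Proof.
(* The value 5 * 1280^2 makes lam^2 m = 5 d ln n for lam = alpha/1280 and m = delta n. It is hidden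
   behind [c] so that the large numeral is not computed with. *)
have [c [c0 CE]] : exists c : RR, 0 < c /\ 5 * 1280 ^+ 2 = c.
  by eexists; split; last reflexivity; rewrite mulr_gt0 ?exprn_gt0 ?ltr0n.
exists c, 1; split; first exact: c0.
split; first exact: ltr01.
move=> n d k alpha X bstar d0 T P Rset eta n2 d1 alpha01 alphaE
  meta mRset unif indep sym dens delta spr h y.
have /andP[a0 a1] := alpha01.
have n0 : (0 < n)%N by lia.
have N0 : 0 < n%:R :> RR by rewrite ltr0n.
have L0 : 0 < ln n%:R :> RR by rewrite ln_gt0 // ltr1n.
have D0 : 0 < d%:R :> RR by rewrite ltr0n.
have delta0 : 0 < delta by rewrite mulr_gt0 // divr_gt0 ?mulr_gt0 // exprn_gt0.
(* If delta >= 1, the spread condition forces X (bhat - beta_star) = 0, and the whole space serves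
   as the event. *)
have [mn|nm] := ltP (delta * n%:R) n%:R; last first.
  exists setT; split; first exact: measurableT.
  split; last by rewrite probability_setT /= gerBl mul1r powR_ge0.
  move=> w _ b _; rewrite (spread_full_trivial _ _ _ _ spr nm); last by exists (b - bstar).
  by rewrite expr0n mul0r ltW.
set m := delta * n%:R in spr mn.
have m0 : 0 < m by rewrite mulr_gt0.
have mE : alpha ^+ 2 * m = 5 * 1280 ^+ 2 * (d%:R * ln n%:R).
  by rewrite CE /m /delta; field; rewrite !gt_eqF.
have kn : (k <= n)%N.
  by rewrite -(ler_nat RR) -alphaE ler_piMl // ltW.
have [I [g [cI gK net]]] := colspan_sphere_net X m n2 m0 mn.
(* The bad event is a finite union over the net, hence measurable, and it does not depend on the
   minimizer; its complement serves all minimizers at once. *)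
pose U := \big[setU/set0]_(a : I) small_sum eta (g a).
have mS a : measurable (small_sum eta (g a)) by exact: measurable_small_sum.
have mU : measurable U by exact: bigsetU_measurable.
exists (~` U); split; first exact: measurableC.
split=> [w nUw b minb|].
  rewrite ler_pdivrMr // -/m leNgt; apply/negP => far; apply: nUw.
  have [a sa] := far_minimizer_small_sum X m n2 m0 mn I g bstar b (eta^~ w) net minb far.
  by apply/bigsetUP; exists a.
rewrite pr_setC // lerD2l lerN2 mul1r.
pose lam : RR := alpha / 1280.
have lam01 : 0 <= lam <= 1 / 2 := chernoff_rate_range _ alpha01.
apply: le_trans (net_failure_bound n d alpha m lam n2 d1 alpha01 mE erefl).
apply: le_trans (pr_bigsetU_le P _ _ _ mS) _.
set B := (X in _ * X).
have bound a : true -> fine (P (small_sum eta (g a))) <= B.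
  move=> _; have [cs gm] := gK a.
  apply: le_trans (pr_small_sum_le P n0 kn alphaE meta mRset unif indep sym dens (g a) lam lam01) _.
  rewrite gm /B ler_wpM2l ?mulr_ge0 ?expR_ge0 // ler_expR lerN2 ler_wpM2l //.
    by case/andP: lam01 => l0 _; rewrite divr_ge0 // mulr_ge0 // ltW.
  exact: (spread_light_mass _ _ _ _ spr cs gm).
apply: le_trans (ler_sum _ bound) _.
rewrite sumr_const -[_ *+ _]mulr_natl ler_wpM2r ?ler_nat //.
by rewrite /B !mulr_ge0 ?expR_ge0.
Qed.
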